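(* Let $(X,d,A)$ be a metric pair with $A\neq\varnothing$ such that the pointed metric space $(X/A,\overline d_1,[A])$ is uniformly discrete, and let $\psi:[0,\infty)\to[0,\infty)$ satisfy $\psi(0)=0$ and $\sum_{x,y\in X\setminus A,\,x\ne y}\psi(\overline d_1(x,y))<\infty$. Let $H\subset K(X,A)$ and $\lambda_H:\widehat H\to[0,\infty)$ be the countable subgroup and the exponent attached to $\psi$ (see context). Then there exists a unique function $\nu:H\setminus\{0\}\to[0,\infty)$ which is symmetric (i.e. $\nu(-\kappa)=\nu(\kappa)$ for all $\kappa$), belongs to $\ell^1(H\setminus\{0\})$, and satisfies, for all $\theta\in\widehat H$, $$\lambda_H(\theta)=\sum_{\kappa\in H\setminus\{0\}}\bigl(1-\Re\,\theta(\kappa)\bigr)\,\nu(\kappa).$$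
   Context: Metric pair: $(X,d)$ is a metric space and $A\subseteq X$ is nonempty. Put $d(x,A)=\inf_{a\in A}d(x,a)$ and $d_1(x,y)=\min(d(x,y),d(x,A)+d(y,A))$. $X/A$ is the quotient collapsing $A$ to a basepoint $[A]$, and $\overline d_1$ is the metric on $X/A$ induced by $d_1$ (so $\overline d_1(x,y)=d_1(x,y)$ and $\overline d_1(x,[A])=d(x,A)$ for $x,y\in X\setminus A$). Uniformly discrete means: there is $c>0$ with $\overline d_1(u,v)\ge c$ for all distinct $u,v\in X/A$. $D(X,A)$ is the free commutative monoid on $X$ modulo the submonoid generated by $A$; $K(X,A)$ is its Grothendieck group, identified with $\bigoplus_{x\in X\setminus A}\mathbb Z e_x$ and regarded as a discrete abelian group. For a discrete abelian group $G$, $\widehat G$ is the compact group of characters $G\to\mathbb T$; the Fourier transform of $p\in\ell^1(G)$ is $\widehat p(\theta)=\sum_{g\in G}p(g)\overline{\theta(g)}$. Sums over possibly uncountable index sets of nonnegative terms are suprema of finite partial sums. For $\theta\in\widehat{K(X,A)}$ put $\lambda^\psi(\theta)=\frac12\sum_{x,y\in X\setminus A,\,x\neq y}\psi(\overline d_1(x,y))\,(1-\Re\,\theta(e_x-e_y))$. $(p_t^\psi)_{t\ge0}$ is the unique convolution semigroup of probability measures on $K(X,A)$ with $\widehat{p_t^\psi}(\theta)=e^{-t\lambda^\psi(\theta)}$ for all $\theta\in\widehat{K(X,A)}$, $t\ge0$. With $\operatorname{supp}(p)=\{g:p(g)>0\}$, $H$ is the subgroup of $K(X,A)$ generated by $\bigcup_{q\in\mathbb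 Q_{\ge0}}\operatorname{supp}(p_q^\psi)$. It is countable and $\operatorname{supp}(p_t^\psi)\subset H$ for all $t\ge0$; hence $p_t^\psi$ is regarded as a probability measure on $H$, and $\lambda_H:\widehat H\to[0,\infty)$ is the function with $\sum_{h\in H}p_t^\psi(h)\overline{\theta(h)}=e^{-t\lambda_H(\theta)}$ for all $\theta\in\widehat H$, $t\ge0$ (equivalently $\lambda_H(\theta)=\lambda^\psi(\tilde\theta)$ for any extension $\tilde\theta\in\widehat{K(X,A)}$ of $\theta$). *)

(* Defs.v *)
From HB Require Import structures.
From mathcomp Require Import all_boot all_order all_algebra generic_quotient.
From mathcomp Require Import all_classical all_reals all_analysis.
From mathcomp Require Export complex.
From mathcomp Require Import freeg.

Set Implicit Arguments.
Unset Strict Implicit.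
Unset Printing Implicit Defensive.

Import Order.TTheory GRing.Theory Num.Theory.
Import numFieldNormedType.Exports.

Local Open Scope classical_set_scope.
Local Open Scope ring_scope.
Local Open Scope quotient_scope.

Section MetricPair.
Context {R : realType} {X : metricType R} (A : set X).

Definition dist_to (x : X) : R := inf [set mdist x a | a in A].

Definition d1 (x y : X) : R :=
  Num.min (mdist x y) (dist_to x + dist_to y).

Definition collapse_rel (x y : X) : bool :=
  (x == y) || ((x \in A) && (y \in A)).

Lemma collapse_refl : reflexive collapse_rel.
Proof. by move=> x; rewrite /collapse_rel eqxx. Qed.

Lemma collapse_sym : symmetric collapse_rel.
Proof. by move=> x y; rewrite /collapse_rel eq_sym andbC. Qed.

Lemma collapse_trans : transitive collapse_rel.
Proof.
move=> y x z; rewrite /collapse_rel.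
move=> /orP[/eqP->//|/andP[xA yA]] /orP[/eqP<-|/andP[_ zA]].
  by rewrite xA yA orbT.
by rewrite xA zA orbT.
Qed.

Canonical collapse_equiv :=
  EquivRel collapse_rel collapse_refl collapse_sym collapse_trans.

Definition collapse : Type := {eq_quot collapse_rel}.
HB.instance Definition _ : EqQuotient X collapse_rel collapse :=
  EqQuotient.on collapse.

(* Does not depend on the representatives, by dbar1_pi below. *)
Definition dbar1 (u v : collapse) : R := d1 (repr u) (repr v).

Definition uniformly_discrete : Prop :=
  exists2 c : R, 0 < c & forall u v : collapse, u != v -> c <= dbar1 u v.

Lemma dist_to_has_inf (x : X) : A !=set0 -> has_inf [set mdist x a | a in A].
Proof.
move=> [a Aa]; split; first by exists (mdist x a), a.
by exists 0 => _ [b _ <-]; exact: mdist_ge0.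
Qed.

Lemma dist_to0 (a : X) : A a -> dist_to a = 0.
Proof.
move=> Aa; have [_ lb] := dist_to_has_inf a (ex_intro _ a Aa).
apply/eqP; rewrite eq_le; apply/andP; split.
  by rewrite -[leRHS](mdistxx a); apply: ge_inf => //; exists a.
by apply: lb_le_inf; [exists (mdist a a), a | move=> _ [b _ <-]; exact: mdist_ge0].
Qed.

Lemma d1_sym (x y : X) : d1 x y = d1 y x.
Proof. by rewrite /d1 metric_sym addrC. Qed.

Lemma d1_base (a y : X) : A a -> d1 a y = dist_to y.
Proof.
move=> Aa; have [_ lb] := dist_to_has_inf y (ex_intro _ a Aa).
rewrite /d1 dist_to0 // add0r; apply/min_idPr; rewrite metric_sym.
by apply: ge_inf => //; exists a.
Qed.

Lemma dbar1_pi (x y : X) : dbar1 (\pi_collapse x) (\pi_collapse y) = d1 x y.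
Proof.
rewrite /dbar1.
have d1l u v w : collapse_rel u v -> d1 u w = d1 v w.
  by move=> /orP[/eqP->//|/andP[/set_mem uA /set_mem vA]]; rewrite !d1_base.
have piE z : collapse_rel (repr (\pi_collapse z)) z.
  by apply/(@eqquotP X collapse_rel collapse); rewrite reprK.
by rewrite (d1l _ _ _ (piE x)) d1_sym (d1l _ _ _ (piE y)) d1_sym.
Qed.

Lemma dbar1_base (x a : X) : A a -> dbar1 (\pi_collapse x) (\pi_collapse a) = dist_to x.
Proof. by move=> Aa; rewrite dbar1_pi d1_sym d1_base. Qed.

(* Killing A in the free commutative monoid on X leaves the free one on X \ A,
   whose Grothendieck group is the free abelian group on X \ A. *)
Definition KXA : Type := {freeg (set_type (~` A)) / int}.
HB.instance Definition _ := GRing.Zmodule.on KXA.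

Definition gen_e (x : set_type (~` A)) : KXA := << x >>.

Definition dbar1_off (x y : set_type (~` A)) : R :=
  dbar1 (\pi_collapse (val x)) (\pi_collapse (val y)).

End MetricPair.

Record character (R : realType) (G : zmodType) := Character {
  char_fun :> G -> R[i];
  char_norm : forall g, `|char_fun g| = 1;
  charD : forall g h, char_fun (g + h) = char_fun g * char_fun h
}.

Section Sums.
Context {R : realType}.

(* Meaningful for absolutely summable families, such as those below. *)
Definition rsum (I : choiceType) (f : I -> R) : R :=
  let F := EFin \o f in
  fine (\esum_(i in setT) F^\+%E i - \esum_(i in setT) F^\-%E i)%E.

Definition csum (I : choiceType) (f : I -> R[i]) : R[i] :=
  (rsum (fun i => complex.Re (f i)) +i* rsum (fun i => complex.Im (f i)))%C.

Definition fourier (G : zmodType) (p : G -> R) (theta : character R G) : R[i] :=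
  csum (fun g => (p g)%:C%C * conjc (theta g)).

Definition is_pmf (G : choiceType) (p : G -> R) : Prop :=
  (forall g, 0 <= p g) /\ (\esum_(g in setT) (p g)%:E = 1)%E.

(* On a discrete group, weak convergence of probability measures to the unit
   mass at 0 is pointwise convergence of the mass functions. *)
Definition is_conv_semigroup (G : zmodType) (p : R -> G -> R) : Prop :=
  [/\ forall t : R, 0 <= t -> is_pmf (p t),
      forall g, p 0 g = (g == 0)%:R,
      forall (s t : R) g, 0 <= s -> 0 <= t ->
        (\esum_(h in setT) (p s h * p t (g - h))%:E = (p (s + t) g)%:E)%E
    & forall g, p t g @[t --> 0^'+] --> ((g == 0)%:R : R)].

Definition supp (G : Type) (p : G -> R) : set G := [set g | 0 < p g].

End Sums.

Section GeneratedSubgroup.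
Context {G : zmodType} (S : set G).

Definition is_subgroup (M : set G) : Prop :=
  M 0 /\ forall x y, M x -> M y -> M (x - y).

Definition gen_subgroup : {pred G} :=
  fun x => `[< smallest is_subgroup S x >].

Lemma gen_subgroup_zmod_closed : zmod_closed gen_subgroup.
Proof.
split=> [|x y /asboolP Mx /asboolP My]; apply/asboolP.
  by move=> M [[M0 _] _].
by move=> M MS; apply: MS.1.2; [exact: Mx | exact: My].
Qed.

HB.instance Definition _ :=
  GRing.isZmodClosed.Build G gen_subgroup gen_subgroup_zmod_closed.

Record gen_subgroup_type := GenElt {
  gen_val : G;
  gen_valP : gen_val \in gen_subgroup
}.

HB.instance Definition _ := [isSub for gen_val].
HB.instance Definition _ := [Choice of gen_subgroup_type by <:].
HB.instance Definition _ :=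
  [SubChoice_isSubZmodule of gen_subgroup_type by <:].

End GeneratedSubgroup.

Section Exponent.
Context {R : realType} {X : metricType R} (A : set X).

Definition offdiag : set (set_type (~` A) * set_type (~` A)) :=
  [set z | z.1 != z.2].

Definition lambda_psi (psi : R -> R) (theta : character R (KXA A)) : R :=
  2^-1 * fine (\esum_(z in offdiag)
    (psi (dbar1_off z.1 z.2) *
       (1 - complex.Re (theta (gen_e z.1 - gen_e z.2))))%:E).

Definition H_of (p : R -> KXA A -> R) : zmodType :=
  gen_subgroup_type
    (\bigcup_(q in [set q : rat | 0 <= q]) supp (p (ratr q))).

Definition H_val (p : R -> KXA A -> R) (h : H_of p) : KXA A := gen_val h.

End Exponent.

Arguments offdiag {R X} A.

Definition nonzero (G : zmodType) : choiceType := {k : G | k != 0}.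

Definition nonzero_val (G : zmodType) (k : nonzero G) : G := val k.

Definition nonzero_opp (G : zmodType) (k : nonzero G) : nonzero G :=
  exist _ (- val k) (etrans (congr1 negb (oppr_eq0 (val k))) (valP k)).

(* Main.v *)
(* Put w(x, y) = psi(d1(x, y)) / 2 and let nu be the pushforward of w by the map
   (x, y) |-> e_x - e_y, so that lambda^psi is formally the Levy-Khintchine
   exponent of nu.  Two characters of K(X, A) that agree on H have the same
   lambda^psi, because p_1 is carried by H.  Hence nu lives on H: if e_x - e_y is
   outside H, some character is trivial on H but not at e_x - e_y (the circle is
   divisible, so characters extend by Zorn's lemma), its exponent vanishes, and
   w(x, y) = 0.  Extending a character of H to K(X, A) then gives the formula for
   lambda_H.

   For uniqueness, let mu be the difference of two solutions.  The symmetry of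
   mu makes sum (phi - phi(0)) mu vanish for every trigonometric polynomial phi
   on H.  Products of functions ((1 + chi(. - k)) / 2)^n, which are bounded by 1
   and equal to 1 at k, approximate the indicator of k on any finite set that
   may include 0, and so mu(k) = 0. *)

Require Import Defs.
From HB Require Import structures.
From mathcomp Require Import all_boot all_order all_algebra.
From mathcomp Require Import finmap.
From mathcomp Require Import all_classical all_reals all_analysis.
From mathcomp Require Import ring lra.
From mathcomp Require summability.

Import Order.TTheory GRing.Theory Num.Theory.
Import numFieldNormedType.Exports.

Local Open Scope classical_set_scope.
Local Open Scope ring_scope.

(** * Extension and separation of characters, by divisibility of the circle and Zorn's lemma *)

Section CharacterExtension.
Context {R : realType} {G : zmodType}.
Implicit Types (g : G) (z w : R[i]) (F : set (G * R[i])).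

(* F is the graph of a character defined on a subgroup of G. *)
Definition char_graph F : Prop :=
  [/\ F (0, 1),
      forall a b, F a -> F b -> F (a.1 - b.1, a.2 / b.2),
      forall a, F a -> `|a.2| = 1
    & forall z, F (0, z) -> z = 1].

Lemma char_graphV F g z : char_graph F -> F (g, z) -> F (- g, z^-1).
Proof.
by move=> [F0 FB _ _] Fg; have := FB _ _ F0 Fg; rewrite /= sub0r div1r.
Qed.

Lemma char_graphM F g h z w : char_graph F -> F (g, z) -> F (h, w) ->
  F (g + h, z * w).
Proof.
move=> cF Fg /(char_graphV _ _ _ cF) Fh; have [_ FB _ _] := cF.
by have := FB _ _ Fg Fh; rewrite /= opprK invrK.
Qed.

Lemma char_graph_fun F g z w : char_graph F -> F (g, z) -> F (g, w) -> z = w.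
Proof.
move=> cF Fz Fw; have [_ FB _ F1] := cF.
have := FB _ _ Fz Fw; rewrite /= subrr => /F1 zw.
by apply: divr1_eq.
Qed.

Lemma char_graphXn F g z n : char_graph F -> F (g, z) -> F (g *+ n, z ^+ n).
Proof.
move=> cF Fg; elim: n => [|n IH]; first by rewrite mulr0n expr0; case: cF.
by rewrite mulrS exprS; exact: char_graphM.
Qed.

Lemma char_graphXz F g z (k : int) : char_graph F -> F (g, z) ->
  F (g *~ k, z ^ k).
Proof.
move=> cF Fg; case: k => n; first exact: char_graphXn.
by rewrite NegzE mulrNz -exprnN; apply: char_graphV => //; exact: char_graphXn.
Qed.

Lemma norm_exprz_eq1 w (k : int) : `|w| = 1 -> `|w ^ k| = 1.
Proof.
move=> w1; case: k => n; first by rewrite -exprnP normrX w1 expr1n.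
by rewrite NegzE -exprnN normfV normrX w1 expr1n invr1.
Qed.

(** The only obstruction to assigning the value [w] to [g] is a multiple of [g] already in the
    domain. If those multiples have the values prescribed by [w], the product formula on sums
    [b + g *~ k] is single-valued. *)
Lemma char_graph_adjoin F g w : char_graph F -> `|w| = 1 ->
    (forall (k : int) z, F (g *~ k, z) -> z = w ^ k) ->
  exists F', [/\ char_graph F', F `<=` F' & F' (g, w)].
Proof.
move=> cF w1 Fw; have [F0 FB Fn F1] := cF.
have w0 : w != 0 by rewrite -normr_gt0 w1 ltr01.
exists [set a | exists b (k : int), F b /\ a = (b.1 + g *~ k, b.2 * w ^ k)].
split.
- split.
  + by exists (0, 1), 0; rewrite mulr0z addr0 expr0z mulr1.
  + move=> _ _ [b [k [Fb ->]]] [c [l [Fc ->]]] /=.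
    exists (b.1 - c.1, b.2 / c.2), (k - l); split; first exact: FB.
    congr pair => /=; first by rewrite mulrzBr opprD addrACA.
    by rewrite invfM mulrACA expfzDr// -invr_expz.
  + by move=> _ [b [k [Fb ->]]] /=; rewrite normrM Fn// mul1r norm_exprz_eq1.
  (* Single-valuedness at 0: [h + g *~ k = 0] puts [g *~ (- k)] in the domain of [F], so
     [u = w ^ (- k)] and the product is 1. *)
  + move=> z [[h u] [k [Fb [/= hk ->]]]].
    have : F (g *~ (- k), u).
      rewrite mulrNz (_ : - (g *~ k) = h)//.
      by apply/esym/eqP; rewrite -addr_eq0 -hk.
    by move=> /Fw ->; rewrite -invr_expz mulVf// expfz_neq0.
- by move=> [h u] Fh; exists (h, u), 0; rewrite mulr0z addr0 expr0z mulr1.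
- by exists (0, 1), 1; rewrite mulr1z add0r expr1z mul1r.
Qed.

(* [n] generates the ideal of the integers [k] such that [g *~ k] lies in the
   domain of F; it is [0] when only [g *~ 0] does. *)
Lemma char_graph_period F g : char_graph F ->
  exists (n : nat) c, F (g *+ n, c) /\
    (forall (k : int) z, F (g *~ k, z) -> exists q : int, k = q * n%:Z).
Proof.
move=> cF; have [F0 FB Fn F1] := cF.
pose period (n : nat) := (0 < n)%N && `[< exists c, F (g *+ n, c) >].
have [ex|no] := pselect (exists n, period n).
  case: (ex_minnP ex) => n' /andP[n0 /asboolP[c Fc]] nmin.
  exists n', c; split=> // k z Fk; exists (k %/ n')%Z.
  (* The remainder also gives a multiple of [g] in the domain; being smaller than the least positive
     period, it is 0. *)
  suff r0 : (k %% n')%Z = 0 by rewrite {1}(divz_eq k n') r0 addr0.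
  have Fr : F (g *~ (k %% n')%Z, z / c ^ (k %/ n')%Z).
    have -> : (k %% n')%Z = k - n'%:Z * (k %/ n')%Z.
      by apply/esym/eqP; rewrite subr_eq addrC mulrC -divz_eq.
    rewrite mulrzBr mulrzA.
    exact: (FB _ _ Fk (char_graphXz _ _ _ (k %/ n')%Z cF Fc)).
  have := ltz_pmod k (_ : 0 < n'%:Z); rewrite ltz_nat => /(_ n0).
  have := modz_ge0 k (_ : n'%:Z != 0); rewrite -lt0n => /(_ n0).
  case E : (k %% n')%Z => [r|//] _; rewrite ltz_nat => rn.
  case: (posnP r) => [-> //|r0].
  have := nmin r; rewrite /period r0 /= leqNgt rn /=.
  move=> H; exfalso; suff : false by [].
  by apply: H; apply/asboolP; exists (z / c ^ (k %/ n')%Z); move: Fr; rewrite E.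
exists 0, 1; split; first by rewrite mulr0n.
move=> k z Fk; exists 0; rewrite mul0r.
apply/eqP; apply: contra_notT no => k0; exists `|k|%N.
rewrite /period absz_gt0 k0; apply/asboolP; case: k Fk {k0} => n Fk; first by exists z.
by exists z^-1; have := char_graphV _ _ _ cF Fk; rewrite NegzE mulrNz opprK.
Qed.

(** Every multiple of [g] in the domain is a multiple of [g *+ n], so compatibility with [w] need
    only be checked there. This supplies the last hypothesis of [char_graph_adjoin]. *)
Lemma char_graph_root F g n c w : char_graph F -> F (g *+ n, c) ->
    (forall (k : int) z, F (g *~ k, z) -> exists q : int, k = q * n%:Z) ->
    w ^+ n = c -> forall (k : int) z, F (g *~ k, z) -> z = w ^ k.
Proof.
move=> cF Fc Fk wc k z Fz; have [q kE] := Fk _ _ Fz; subst k.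
apply: (char_graph_fun _ _ _ _ cF Fz).
by rewrite mulrC mulrzA -exprz_exp -exprnP wc; exact: char_graphXz.
Qed.

Lemma norm_root_eq1 w n : (0 < n)%N -> `|w ^+ n| = 1 -> `|w| = 1.
Proof.
by move=> n0 /eqP; rewrite normrX pexpr_eq1 ?normr_ge0// => /eqP.
Qed.

Lemma char_graph_total F : char_graph F ->
  exists chi : character R G, forall g z, F (g, z) -> chi g = z.
Proof.
move=> cF.
(* Zorn's lemma is applied to the sets added to [F], not to the graphs themselves, so that the empty
   chain yields [F] and needs no lower bound. *)
have [|E [cE Emax]] := @Zorn_bigcup _ [set E | char_graph (F `|` E)].
  move=> K Kgood Ktot.
  have sup2 E1 E2 : K E1 -> K E2 -> exists2 E, char_graph (F `|` E) &
      [/\ E1 `<=` E, E2 `<=` E & K E].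
    move=> K1 K2; case: (Ktot _ _ K1 K2) => le12.
      by exists E2; [exact: Kgood | split].
    by exists E1; [exact: Kgood | split].
  (* Each closure condition involves at most two points, and any two points of the union lie in a
     single graph of the chain, or in [F] alone. *)
  have supU a b :
      (F `|` \bigcup_(X in K) X) a -> (F `|` \bigcup_(X in K) X) b ->
      exists E, [/\ char_graph (F `|` E), (F `|` E) a, (F `|` E) b &
         F `|` E `<=` F `|` \bigcup_(X in K) X].
    have KU E : K E -> F `|` E `<=` F `|` \bigcup_(X in K) X.
      by move=> KE x [Fx|Ex]; [left|right; exists E].
    move=> [Fa|[E1 K1 E1a]] [Fb|[E2 K2 E2b]].
    - by exists set0; rewrite setU0; split => // x Fx; left.
    - by exists E2; split; [exact: Kgood|left|right|exact: KU].
    - by exists E1; split; [exact: Kgood|right|left|exact: KU].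
    - have [E cE [E1E E2E KE]] := sup2 _ _ K1 K2.
      by exists E; split => //; [right; exact: E1E|right; exact: E2E|exact: KU].
  have [F0 FB Fn F1] := cF; split.
  - by left.
  - move=> a b Fa Fb; have [E [cE Ea Eb EU]] := supU _ _ Fa Fb.
    by apply: EU; case: cE => _ EB _ _; exact: EB.
  - move=> a Fa; have [E [cE Ea _ _]] := supU _ _ Fa Fa.
    by case: cE => _ _ En _; exact: En.
  - move=> z Fz; have [E [cE Ea _ _]] := supU _ _ Fz Fz.
    by case: cE => _ _ _ E1; exact: E1.
have dom g : exists z, (F `|` E) (g, z).
  have [n [c [Fc Fk]]] := char_graph_period _ g cE.
  (* If [n = 0], then [c] is the value at 0, hence 1, and any [w] of modulus 1 would do. Otherwise
     an [n]-th root of [c] is taken. *)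
  have [w w1 wc] : exists2 w, `|w| = 1 & w ^+ n = c.
    have [n0|n0] := posnP n.
      exists 1; rewrite ?normr1// n0 expr0; apply/esym.
      by case: cE => _ _ _; apply; move: Fc; rewrite n0 mulr0n.
    exists (n.-root c); last by rewrite rootCK.
    apply: (@norm_root_eq1 _ n) => //; rewrite rootCK//.
    by case: cE => _ _ + _ => /(_ _ Fc).
  have [F' [cF' FF' F'g]] :=
    char_graph_adjoin _ _ _ cE w1 (char_graph_root _ _ _ _ _ cE Fc Fk wc).
  exists w; apply: contrapT => nEw; apply: (Emax F'); last first.
    by rewrite /= setUidr// => x Fx; apply: FF'; left.
  split; last by move=> /(_ _ F'g) ?; apply: nEw; right.
  by move=> x Ex; apply: FF'; right.
pose chi g := projT1 (cid (dom g)).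
have chiP g : (F `|` E) (g, chi g) by rewrite /chi; case: cid.
have chi1 g : `|chi g| = 1 by case: cE => _ _ + _ => /(_ _ (chiP g)).
have chiD g h : chi (g + h) = chi g * chi h.
  by apply: (char_graph_fun _ _ _ _ cE (chiP _)); exact: char_graphM.
exists (@Character R G chi chi1 chiD) => g z Fg /=.
by apply: (char_graph_fun _ _ _ _ cE (chiP _)); left.
Qed.

Lemma char0 (chi : character R G) : chi 0 = 1.
Proof.
have := charD chi 0 0; rewrite addr0 => h.
have c0 : chi 0 != 0 by rewrite -normr_gt0 char_norm ltr01.
by apply: (mulfI c0); rewrite mulr1.
Qed.

Lemma charN (chi : character R G) g : chi (- g) = conjc (chi g).
Proof.
have c0 : chi g != 0 by rewrite -normr_gt0 char_norm ltr01.
apply: (mulfI c0); rewrite -charD subrr char0.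
by have := @normCK _ (chi g); rewrite char_norm expr1n => ->.
Qed.

Lemma character_extends (M : set G) (f : G -> R[i]) : is_subgroup M ->
    (forall g, M g -> `|f g| = 1) ->
    (forall g h, M g -> M h -> f (g + h) = f g * f h) ->
  exists chi : character R G, forall g, M g -> chi g = f g.
Proof.
move=> [M0 MB] f1 fD.
have MN h : M h -> M (- h) by move=> Mh; rewrite -sub0r; exact: MB.
have fn0 g : M g -> f g != 0 by move=> Mg; rewrite -normr_gt0 f1// ltr01.
have f0 : f 0 = 1.
  apply: (mulfI (fn0 _ M0)); rewrite -fD// addr0 mulr1//.
have cF : char_graph [set a | M a.1 /\ a.2 = f a.1].
  split => /=.
  - by split.
  - move=> [a u] [b v] /= [Ma ->] [Mb ->]; split; first exact: MB.
    apply: (mulIf (fn0 _ Mb)); rewrite -fD// ?subrK ?divfK ?fn0//; exact: MB.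
  - by move=> [a u] /= [Ma ->]; exact: f1.
  - by move=> z [_ ->].
have [chi chiE] := char_graph_total _ cF.
by exists chi => g Mg; apply: chiE.
Qed.

(** For [n = 0] the equation is void and -1 works. For [n >= 2], a root of [1 + X + ... + X^(n-1)]
    works: it is not 1, since the value of this polynomial at 1 is [n]. *)
Lemma root_of_unity_neq1 n : n != 1%N ->
  exists w : R[i], [/\ w ^+ n = 1, `|w| = 1 & w != 1].
Proof.
case: n => [|[//|n]] _.
  exists (- 1); rewrite expr0 normrN1; split => //.
  by rewrite -subr_eq0 -opprD oppr_eq0 -(natrD _ 1 1) pnatr_eq0.
pose P : {poly R[i]} := \sum_(i < n.+2) 'X^i.
have Pn : 'X ^+ n.+2 - 1 = ('X - 1) * P.
  by rewrite subrX1.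
have P1 : P.[1] != 0.
  rewrite /P horner_sum (eq_bigr (fun=> 1)); last first.
    by move=> i _; rewrite hornerXn expr1n.
  by rewrite sumr_const card_ord pnatr_eq0.
(* [P] is not constant: otherwise [('X - 1) * P] would have degree 1 instead of [n + 2]. *)
have sP : size P != 1%N.
  apply/eqP => sP; have := congr1 (size \o polyseq) Pn.
  rewrite /= size_XnsubC// size_monicM ?monicXsubC//; last first.
    by rewrite -size_poly_eq0 sP.
  by rewrite sP size_XsubC.
have [w /rootP Pw] := closed_rootP P sP.
have wn : w ^+ n.+2 = 1.
  apply/eqP; rewrite -subr_eq0.
  have := congr1 (fun p => p.[w]) Pn.
  by rewrite hornerM Pw mulr0 hornerD hornerN hornerXn hornerC => ->.
exists w; split => //.
  by apply: (@norm_root_eq1 _ n.+2) => //; rewrite wn normr1.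
by apply: contra_neq P1 => <-.
Qed.

(** The trivial character of [M] is extended. Since [g] is outside [M], its period modulo [M] is not
    1, so a nontrivial root of unity is a compatible value at [g]. *)
Lemma character_separates (M : set G) g : is_subgroup M -> ~ M g ->
  exists chi : character R G, (forall h, M h -> chi h = 1) /\ chi g != 1.
Proof.
move=> [M0 MB] nMg.
have cF : char_graph [set a | M a.1 /\ a.2 = 1].
  split => //=.
  - by move=> [a u] [b v] /= [Ma ->] [Mb ->]; split; [exact: MB|rewrite divr1].
  - by move=> [a u] /= [_ ->]; rewrite normr1.
  - by move=> z [].
have [n [c [[/= Mn c1] Fk]]] := char_graph_period _ g cF.
have n1 : n != 1%N by apply: contra_not_neq nMg => n1; move: Mn; rewrite n1.
have [w [wn w1 wN1]] := root_of_unity_neq1 n n1.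
have Fc : [set a | M a.1 /\ a.2 = 1] (g *+ n, c) by [].
have wc : w ^+ n = c by rewrite wn c1.
have [F' [cF' FF' F'g]] :=
    char_graph_adjoin _ _ _ cF w1 (char_graph_root _ _ _ _ _ cF Fc Fk wc).
have [chi chiE] := char_graph_total _ cF'.
exists chi; split; last by rewrite (chiE _ _ F'g).
by move=> h Mh; apply: chiE; exact: FF'.
Qed.

End CharacterExtension.

(** * Sums over fibres, reindexing, and Fourier transforms of measures carried by a subgroup *)

Section Sums.
Context {R : realType}.

Lemma esumZl (T : choiceType) (D : set T) (r : R) (f : T -> \bar R) :
  0 <= r -> (forall x, 0 <= f x)%E ->
  (\esum_(x in D) (r%:E * f x) = r%:E * \esum_(x in D) f x)%E.
Proof.
move=> r0 f0; rewrite /esum -ereal_supZl//; last first.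
  by apply/set0P; exists 0%E, set0; [exact: fsets_set0 | rewrite fsbig_set0].
rewrite image_comp; congr ereal_sup; apply: eq_imagel => B _.
by rewrite /= ge0_mule_fsumr.
Qed.

(** Summation by disjoint fibres, which need to cover only the points of [D] where [f] is
    nonzero. *)
Lemma esum_fiber (T K : choiceType) (D : set T) (C : K -> set T)
    (f : T -> \bar R) :
    (forall z, 0 <= f z)%E -> (forall k l z, C k z -> C l z -> k = l) ->
    (forall z, D z -> f z != 0%E -> exists k, C k z) ->
  (\esum_(k in setT) \esum_(z in D `&` C k) f z = \esum_(z in D) f z)%E.
Proof.
move=> f0 Cinj Ccov.
have -> : (\esum_(z in D) f z =
    \esum_(z in [set z | D z /\ exists k, C k z]) f z)%E.
  rewrite esum_mkcond [RHS]esum_mkcond; apply: eq_esum => z _.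
  case: ifPn; rewrite (inE, notin_setE) => Dz; last first.
    by rewrite ifF//; apply/negbTE; rewrite notin_setE => -[].
  case: ifPn => //; rewrite notin_setE => nC; apply/eqP.
  by apply: contra_notT nC => fz; split => //; exact: Ccov.
rewrite esum_esum => [|k z _ _]; last exact: f0.
apply/esym; apply: (@reindex_esum _ _ _ _ _ snd); split.
- by move=> [k z] [_ [/= Dz Cz]]; split => //; exists k.
- move=> [k z] [l z'] /set_mem[_ /= [_ Cz]] /set_mem[_ /= [_ Cz']] /= zz'.
  by subst z'; rewrite (Cinj _ _ _ Cz Cz').
- by move=> z [Dz [k Cz]]; exists (k, z).
Qed.

Lemma rsum_inj (I J : choiceType) (e : J -> I) (f : I -> R) :
    injective e -> (forall i, f i != 0 -> range e i) ->
  rsum f = rsum (f \o e).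
Proof.
move=> inj supf.
have E (h : R -> \bar R) : h 0 = 0%E ->
    (\esum_(i in setT) h (f i) = \esum_(j in setT) h (f (e j)))%E.
  move=> h0; rewrite -[RHS](esum_image setT e (h \o f)); last first.
    by move=> x y _ _; exact: inj.
  rewrite [RHS]esum_mkcond; apply: eq_esum => i _ /=.
  case: ifPn => //; rewrite notin_setE => nr.
  have [->//|/supf/nr//] := eqVneq (f i) 0.
rewrite /rsum; congr (fine (_ - _)%E).
- under eq_esum do rewrite funeposE; under [RHS]eq_esum do rewrite funeposE.
  by apply: (E (fun x => maxe x%:E 0)); rewrite /= maxxx.
- under eq_esum do rewrite funenegE; under [RHS]eq_esum do rewrite funenegE.
  by apply: (E (fun x => maxe (- x%:E)%E 0%E)); rewrite /= oppr0 maxxx.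
Qed.

Lemma char_Re_le1 (G : zmodType) (chi : character R G) g :
  complex.Re (chi g) <= 1.
Proof.
apply: le_trans (ler_norm _) _.
by have := normc_ge_Re (chi g); rewrite char_norm lecR.
Qed.

Lemma char_Re_geN1 (G : zmodType) (chi : character R G) g :
  - 1 <= complex.Re (chi g).
Proof.
have := normc_ge_Re (chi g); rewrite char_norm lecR ler_norml.
by case/andP.
Qed.

(** The only point of the unit circle with real part at least 1 is 1 itself. *)
Lemma char_eq1 (G : zmodType) (chi : character R G) g :
  1 <= complex.Re (chi g) -> chi g = 1.
Proof.
move=> re1.
have re : complex.Re (chi g) = 1 by apply/le_anti; rewrite re1 char_Re_le1.
have := add_Re2_Im2 (chi g); rewrite char_norm expr1n re expr1n.
case: (chi g) re => a b /= -> [] /eqP; rewrite -subr_eq0 addrAC subrr add0r.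
by rewrite sqrf_eq0 => /eqP ->.
Qed.

Definition char_triv (G : zmodType) : character R G :=
  @Character R G (fun=> 1) (fun=> @normr1 _) (fun _ _ => esym (mulr1 1)).

Lemma fourier_ext (G : zmodType) (p : G -> R) (chi1 chi2 : character R G) :
  (forall g, p g != 0 -> chi1 g = chi2 g) -> fourier p chi1 = fourier p chi2.
Proof.
move=> e; congr csum; apply/funext => g.
by have [->|/e ->//] := eqVneq (p g) 0; rewrite !mul0r.
Qed.

Lemma fourier_restrict (G H : zmodType) (e : H -> G) (p : G -> R)
    (chi : character R G) (theta : character R H) :
    injective e -> (forall g, p g != 0 -> range e g) ->
    (forall h, chi (e h) = theta h) ->
  fourier p chi = fourier (p \o e) theta.
Proof.
move=> inj supp ext.
have E (u : R[i] -> R) : u 0 = 0 ->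
    rsum (fun g => u ((p g)%:C%C * conjc (chi g))) =
    rsum (fun h => u ((p (e h))%:C%C * conjc (theta h))).
  move=> u0; rewrite (rsum_inj _ _ e)//.
    by congr rsum; apply/funext => h /=; rewrite ext.
  move=> g; apply: contra_neqP => /(contra_not (supp g))/negP.
  by rewrite negbK => /eqP ->; rewrite mul0r u0.
by rewrite /fourier /csum !E.
Qed.

End Sums.

(** * The pushforward measure and its Lévy-Khintchine formula *)

Section LevyMeasure.
Context {R : realType} {G : zmodType} {T : choiceType}.
Context (D : set T) (w : T -> R) (d : T -> G) (S : set G).
Context (w_ge0 : forall z, 0 <= w z).
Context (w_sum : (\esum_(z in D) (w z)%:E < +oo)%E).

(** This is [lambda_psi] for abstract weights [w] and jumps [d]; the two agree by conversion when
    [d] sends a pair to the difference of its generators. *)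
Definition jump_exponent (chi : character R G) : R :=
  2^-1 * fine (\esum_(z in D) (w z * (1 - complex.Re (chi (d z))))%:E).

Context (exponent_ext : forall chi1 chi2 : character R G,
  (forall g, g \in gen_subgroup S -> chi1 g = chi2 g) ->
  jump_exponent chi1 = jump_exponent chi2).

Local Notation H := (gen_subgroup_type S).

Lemma jump_ge0 (chi : character R G) z :
  (0 <= (w z * (1 - complex.Re (chi (d z))))%:E)%E.
Proof. by rewrite lee_fin mulr_ge0// subr_ge0 char_Re_le1. Qed.

Lemma jump_sum_fin (chi : character R G) :
  \esum_(z in D) (w z * (1 - complex.Re (chi (d z))))%:E \is a fin_num.
Proof.
rewrite ge0_fin_numE; last by apply: esum_ge0 => z _; exact: jump_ge0.
apply: (@le_lt_trans _ _ (\esum_(z in D) (2%:E * (w z)%:E))%E).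
  apply: le_esum => z _; rewrite -EFinM lee_fin mulrC ler_wpM2r//.
  by have := char_Re_geN1 _ chi (d z); lra.
rewrite esumZl//.
by apply: lte_mul_pinfty => //; rewrite lee_fin.
Qed.

(* Otherwise a character trivial on the subgroup but not at [d z] would have a
   positive exponent, unlike the trivial character. *)
Lemma jump_in_subgroup z : D z -> w z != 0 -> d z \in gen_subgroup S.
Proof.
move=> Dz wz0; apply: contraT => /negP dz.
have subM : is_subgroup [set g | g \in gen_subgroup S].
  by have [M0 MB] := gen_subgroup_zmod_closed S; split => [//|x y]; exact: MB.
have [chi [chiM /negP[]]] := character_separates (R := R) _ _ subM dz.
have /eqP : jump_exponent chi = jump_exponent (char_triv G).
  by apply: exponent_ext => g /chiM ->.
rewrite {2}/jump_exponent esum1 ?mulr0; last first.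
  by move=> x _ /=; rewrite subrr mulr0.
rewrite mulf_eq0 invr_eq0 pnatr_eq0 /= => /eqP s0.
have {}s0 : (\esum_(z in D) (w z * (1 - complex.Re (chi (d z))))%:E = 0)%E.
  by rewrite -[LHS]fineK ?s0// jump_sum_fin.
apply/eqP/char_eq1; rewrite -subr_le0 -(pmulr_rle0 _ (_ : 0 < w z)); last first.
  by rewrite lt0r wz0 w_ge0.
rewrite -lee_fin (_ : 0%:E = 0%E)// -s0; apply: esum_ge.
exists [set z]; last by rewrite fsbig_set1.
by split; [exact: finite_set1 | move=> _ ->].
Qed.

Definition levy_measure (k : nonzero H) : R :=
  2^-1 * fine (\esum_(z in D `&` [set z | d z = gen_val (val k)]) (w z)%:E).

Lemma levy_measure_ge0 k : 0 <= levy_measure k.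
Proof.
rewrite mulr_ge0 ?invr_ge0// fine_ge0// esum_ge0// => z _.
by rewrite lee_fin.
Qed.

Lemma levy_measureE k : (levy_measure k)%:E =
  (2^-1%:E * \esum_(z in D `&` [set z | d z = gen_val (val k)]) (w z)%:E)%E.
Proof.
rewrite EFinM fineK// ge0_fin_numE; last by apply: esum_ge0 => z _; rewrite lee_fin.
apply: le_lt_trans w_sum.
rewrite esum_mkcond [leRHS]esum_mkcond; apply: le_esum => z _.
by rewrite in_setI; case: (z \in D) => //=; case: ifP; rewrite // lee_fin.
Qed.

(** The involution reverses jumps and preserves weights, hence exchanges the fibres over [k] and
    [- k]. *)
Lemma levy_measure_sym (s : T -> T) : involutive s ->
    (forall z, D z -> D (s z)) -> (forall z, w (s z) = w z) ->
    (forall z, d (s z) = - d z) ->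
  forall k, levy_measure (nonzero_opp k) = levy_measure k.
Proof.
move=> sK Ds ws ds k; apply: EFin_inj; rewrite !levy_measureE; congr (_ * _)%E.
rewrite (@reindex_esum _ _ _ (D `&` [set z | d z = gen_val (val k)]) _ s).
  by apply: eq_esum => z _; rewrite ws.
split.
- by move=> z [Dz /= dz]; split => /=; [exact: Ds | rewrite ds dz].
- by move=> x y _ _; exact: (can_inj sK).
- move=> z [Dz /= dz]; exists (s z) => //; split => /=; first exact: Ds.
  by rewrite ds dz /= opprK.
Qed.

Lemma jump_fiber_sum (f : T -> \bar R) : (forall z, 0 <= f z)%E ->
    (forall z, D z -> f z != 0%E -> d z \in gen_subgroup S /\ d z != 0) ->
  (\esum_(k in [set: nonzero H])
     \esum_(z in D `&` [set z | d z = gen_val (val k)]) f z =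
   \esum_(z in D) f z)%E.
Proof.
move=> f0 fd; apply: esum_fiber => //=.
  by move=> k l z -> /val_inj/val_inj.
move=> z Dz fz; have [dH d0] := fd _ Dz fz.
have h0 : GenElt dH != 0 :> H by rewrite -val_eqE.
by exists (exist (fun x : H => x != 0) _ h0).
Qed.

(** A pushforward has no more mass than its source, here half the total weight. *)
Lemma levy_measure_summable :
  summable [set: nonzero H] (fun k => (levy_measure k)%:E).
Proof.
rewrite /summable.
apply: (@le_lt_trans _ _ (2^-1%:E * \esum_(z in D) (w z)%:E)%E); last first.
  by apply: lte_mul_pinfty => //; rewrite lee_fin invr_ge0.
(* Zero jumps lie in no fibre over a nonzero element, so their weight is removed before summing by
   fibres. *)
pose f z : \bar R := (if d z == 0 then 0 else w z)%:E.
have f0 z : (0 <= f z)%E by rewrite /f lee_fin; case: ifP.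
apply: (@le_trans _ _ (2^-1%:E * \esum_(z in D) f z)%E); last first.
  rewrite lee_pmul2l// ?lte_fin ?invr_gt0//; apply: le_esum => z _.
  by rewrite /f lee_fin; case: ifP.
rewrite -jump_fiber_sum//; last first.
  move=> z Dz; rewrite /f; case: (eqVneq (d z) 0) => [_ /eqP//|dz].
  move=> wz; split => //; apply: (jump_in_subgroup _ Dz).
  by apply: contra_neq wz => ->.
rewrite -esumZl ?invr_ge0//; last by move=> k; apply: esum_ge0.
apply: le_esum => k _; rewrite gee0_abs ?lee_fin ?levy_measure_ge0//.
rewrite levy_measureE lee_pmul2l// ?lte_fin ?invr_gt0//.
apply: le_esum => z [_ /= dz]; rewrite /f ifF// dz.
by apply/negbTE; exact: (valP k).
Qed.

(** The factor [1 - Re chi] is constant on each fibre of [d], and zero jumps contribute nothing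
    because [chi 0 = 1]. *)
Lemma levy_khintchine (chi : character R G) (theta : character R H) :
    (forall h, chi (gen_val h) = theta h) ->
  (jump_exponent chi)%:E = \esum_(k in [set: nonzero H])
    ((1 - complex.Re (theta (nonzero_val k))) * levy_measure k)%:E.
Proof.
move=> ext; rewrite /jump_exponent EFinM fineK ?jump_sum_fin//.
rewrite -jump_fiber_sum; last 2 first.
- by move=> z; exact: jump_ge0.
- move=> z Dz ne; split.
    by apply: (jump_in_subgroup _ Dz); apply: contra_neq ne => ->; rewrite mul0r.
  by apply: contra_neq ne => ->; rewrite char0 subrr mulr0.
rewrite -esumZl ?invr_ge0//; last first.
  by move=> k; apply: esum_ge0 => z _; exact: jump_ge0.
apply: eq_esum => k _; rewrite EFinM levy_measureE muleCA; congr (_ * _)%E.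
rewrite -esumZl ?subr_ge0 ?char_Re_le1//.
apply: eq_esum => z [_ /= dz].
by rewrite dz ext -EFinM mulrC.
Qed.

End LevyMeasure.

(** * Unordered sums of signed families *)

Section HasSum.
Context {R : realType} {I : choiceType}.
Implicit Types (f g : I -> R) (s t : R).

#[local] Existing Instance summability.totally_filter.

(** Convergence along the finite subsets ordered by inclusion, which makes sense for terms of either
    sign. *)
Definition has_sum f s : Prop :=
  (fun J : {fset I} => \sum_(i <- J) f i : R^o) @ summability.totally --> (s : R^o).

Lemma has_sumP f s : has_sum f s <-> forall e, 0 < e ->
  exists F : {fset I}, forall J : {fset I}, (F `<=` J)%fset ->
    `|s - \sum_(i <- J) f i| < e.
Proof.
rewrite /has_sum cvgrPdist_lt; split => h e /h.
  by move=> [F _ hF]; exists F.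
by move=> [F hF]; exists F.
Qed.

Lemma has_sumD f g s t : has_sum f s -> has_sum g t ->
  has_sum (fun i => f i + g i) (s + t).
Proof.
move=> hf hg; rewrite /has_sum.
under eq_fun do rewrite big_split.
exact: cvgD.
Qed.

Lemma has_sumZ f s c : has_sum f s -> has_sum (fun i => c * f i) (c * s).
Proof.
move=> hf; rewrite /has_sum.
under eq_fun do rewrite -mulr_sumr.
exact: cvgMr hf.
Qed.

Lemma has_sumB f g s t : has_sum f s -> has_sum g t ->
  has_sum (fun i => f i - g i) (s - t).
Proof.
move=> hf hg; have := has_sumD _ _ _ _ hf (has_sumZ _ _ (- 1) hg).
by rewrite mulN1r; under eq_fun do rewrite mulN1r.
Qed.

(** Some finite set comes within [e] of the supremum, and the sum over any larger finite set stays
    between the two. *)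
Lemma esum_has_sum f s : (forall i, 0 <= f i) ->
  (\esum_(i in setT) (f i)%:E = s%:E)%E -> has_sum f s.
Proof.
move=> f0 fs; apply/has_sumP => e e0.
have : ((s - e)%:E < \esum_(i in setT) (f i)%:E)%E.
  by rewrite fs lte_fin ltrBlDr ltrDl.
move=> /ereal_sup_gt[_ [B [finB _] <-]].
rewrite fsbig_finite//= sumEFin lte_fin => sB.
exists (fset_set B) => J BJ.
have leJ : \sum_(i <- J) f i <= s.
  rewrite -lee_fin -fs; apply: esum_ge; exists [set` J]; first by split.
  by rewrite fsbig_finite//= set_fsetK sumEFin.
rewrite ger0_norm ?subr_ge0// ltrBlDr -ltrBlDl (lt_le_trans sB)//.
rewrite [leRHS](big_fsetID _ (mem (fset_set B)))/= -[leLHS]addr0.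
apply: lerD; last by apply: sumr_ge0 => i _; exact: f0.
rewrite le_eqVlt; apply/orP; left; apply/eqP; apply: eq_fbigl => i.
rewrite !inE /=; case: (boolP (i \in fset_set B)) => [iB|]; last by rewrite andbF.
by rewrite (fsubsetP BJ).
Qed.

End HasSum.

(** * Approximate indicators built from characters *)

Section Indicator.
Context {R : realType} {H : zmodType}.
Implicit Types (h f : H) (phi : H -> R[i]).

(** The midpoint of 1 and another point [z] of the circle is strictly inside the disc: its squared
    modulus is [(1 + Re z) / 2]. *)
Lemma norm_half_lt1 (chi : character R H) h : chi h != 1 ->
  exists2 r : R, 0 <= r < 1 & `|(1 + chi h) / 2| = r%:C%C.
Proof.
move=> c1; have re : complex.Re (chi h) < 1.
  by rewrite ltNge; apply: contra c1 => /char_eq1 ->.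
exists (Num.sqrt ((1 + complex.Re (chi h)) / 2)).
  rewrite sqrtr_ge0 /= -[ltRHS]sqrtr1 ltr_sqrt ?ltr01//.
  by rewrite ltr_pdivrMr// mul1r -[2]/(1 + 1) ltrD2l.
have := add_Re2_Im2 (chi h); rewrite char_norm expr1n.
case: (chi h) => a b /= [ab].
have -> : (1 + (a +i* b)%C) / 2 = (((1 + a) / 2) +i* (b / 2))%C.
  have two0 : (2 : R[i]) != 0 by rewrite pnatr_eq0.
  apply: (mulIf two0); rewrite divfK//.
  rewrite (_ : 2 = (2 : R)%:C%C); last by rewrite rmorph_nat.
  by simpc; rewrite !mulfVK//.
rewrite normc_def /=; congr (Num.sqrt _)%:C%C.
transitivity ((1 + 2 * a + (a ^+ 2 + b ^+ 2)) / 4); first by field.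
by rewrite ab; field.
Qed.

(** A character that is not 1 at [f - k] makes the midpoint smaller than 1 in modulus at [f]; a high
    power then brings it below [e]. *)
Lemma character_bump (k f : H) (e : R) : f != k -> 0 < e ->
  exists (chi : character R H) (n : nat),
    let q h := ((1 + chi (h - k)) / 2) ^+ n in
    [/\ q k = 1, forall h, `|q h| <= 1 & `|q f| <= e%:C%C].
Proof.
move=> fk e0.
have sub0 : is_subgroup [set 0 : H] by split => // x y -> ->; rewrite subrr.
have nfk : ~ [set 0 : H] (f - k).
  by move=> /= /eqP; rewrite subr_eq0; exact/negP.
have [chi [_ chi1]] := character_separates (R := R) _ _ sub0 nfk.
have [r /andP[r0 r1] rE] := norm_half_lt1 _ _ chi1.
have [n rn] : exists n, r ^+ n <= e.
  have /cvgrPdist_le/(_ _ e0)[n _ /(_ n (leqnn n))] :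
      (fun n => r ^+ n) @ \oo --> (0 : R).
    by apply: cvg_expr; rewrite ger0_norm.
  by rewrite sub0r normrN => /(le_trans (ler_norm _)); exists n.
have two0 : (2 : R[i]) != 0 by rewrite pnatr_eq0.
exists chi, n => q; split.
- by rewrite /q subrr char0 -[1 + 1]/2 divff// expr1n.
- move=> h; rewrite /q normrX exprn_ile1// normrM normfV normr_nat.
  rewrite ler_pdivrMr ?ltr0n// mul1r (le_trans (ler_normD _ _))//.
  by rewrite normr1 char_norm.
- by rewrite /q normrX rE -rmorphXn lecR.
Qed.

(* P is only required to be stable under multiplication by [a + b * chi], which
   spares proving that trigonometric polynomials form an algebra. *)
Lemma indicator_approx (P : (H -> R[i]) -> Prop) (k : H) (F : seq H) (e : R) :
    P (fun=> 1) ->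
    (forall phi (a b : R[i]) (chi : character R H),
       P phi -> P (fun h => phi h * (a + b * chi h))) ->
    k \notin F -> 0 < e ->
  exists phi, [/\ P phi, phi k = 1, forall h, `|phi h| <= 1
    & forall f, f \in F -> `|phi f| <= e%:C%C].
Proof.
move=> P1 PM + e0; elim: F => [|f F IH].
  by exists (fun=> 1); split; rewrite ?normr1.
rewrite inE negb_or eq_sym => /andP[fk kF].
have [phi [Pphi phik phi1 phiF]] := IH kF.
have [chi [n [qk q1 qf]]] := character_bump _ _ _ fk e0.
exists (fun h => phi h * ((1 + chi (h - k)) / 2) ^+ n); split.
- elim: n {qk q1 qf} => [|n IHn].
    by under eq_fun do rewrite expr0 mulr1.
  have := PM _ (1 / 2) (chi (- k) / 2) chi IHn.
  congr P; apply/funext => h; rewrite charD exprSr -mulrA; congr (_ * (_ * _)).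
  by rewrite mulrDl mulrAC [chi h * _]mulrC.
- by rewrite phik qk mul1r.
- by move=> h; rewrite normrM mulr_ile1.
- move=> g; rewrite inE => /predU1P[->|gF]; rewrite normrM.
    by rewrite (le_trans _ qf)// ler_piMl.
  by rewrite (le_trans _ (phiF _ gF))// ler_piMr.
Qed.

End Indicator.

(** * Uniqueness of the symmetric measure *)

Section LevyUnique.
Context {R : realType} {H : zmodType}.
Implicit Types (nu mu : nonzero H -> R) (chi : character R H).

Lemma summable_le_fin nu (c : R) (u : nonzero H -> R) :
    (forall k, 0 <= nu k) -> summable [set: nonzero H] (fun k => (nu k)%:E) ->
    (forall k, 0 <= u k <= c) ->
  exists s : R, (\esum_(k in [set: nonzero H]) (u k * nu k)%:E = s%:E)%E.
Proof.
move=> nu0 nus uc.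
(* The bounds on [u] give [0 <= c] only if there is an index; the empty sum is treated apart. *)
have [k0|no] := pselect (exists k : nonzero H, True); last first.
  exists 0; apply: esum1 => k _; exfalso; apply: no; by exists k.
have c0 : 0 <= c by case: k0 => k _; case/andP: (uc k); exact: le_trans.
exists (fine (\esum_(k in [set: nonzero H]) (u k * nu k)%:E)).
rewrite fineK// ge0_fin_numE; last first.
  by apply: esum_ge0 => k _; rewrite lee_fin mulr_ge0//; case/andP: (uc k).
apply: (@le_lt_trans _ _ (\esum_(k in [set: nonzero H]) (c%:E * (nu k)%:E))%E).
  apply: le_esum => k _; rewrite -EFinM lee_fin ler_wpM2r//.
  by case/andP: (uc k).
rewrite esumZl//; apply: lte_mul_pinfty => //.
rewrite (le_lt_trans _ nus)//; apply: le_esum => k _.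
by rewrite gee0_abs ?lee_fin.
Qed.

Lemma char_Im_norm_le1 chi h : `|complex.Im (chi h)| <= 1.
Proof.
rewrite -(@ler_pXn2r _ 2) ?nnegrE// expr1n real_normK ?num_real//.
have := add_Re2_Im2 (chi h); rewrite char_norm expr1n => -[<-].
by rewrite lerDr sqr_ge0.
Qed.

(** Negation of [k] changes the sign of the imaginary part, so the weights [1 + Im] and [1 - Im],
    both nonnegative, have equal finite sums. Half their difference is the sum in question. *)
Lemma has_sum_Im nu chi : (forall k, 0 <= nu k) ->
    (forall k, nu (nonzero_opp k) = nu k) ->
    summable [set: nonzero H] (fun k => (nu k)%:E) ->
  has_sum (fun k => complex.Im (chi (nonzero_val k)) * nu k) 0.
Proof.
move=> nu0 nuN nus.
have bnd (k : nonzero H) : 0 <= 1 + complex.Im (chi (nonzero_val k)) <= 2.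
  have := char_Im_norm_le1 chi (nonzero_val k); rewrite ler_norml; lra.
have bndN (k : nonzero H) : 0 <= 1 - complex.Im (chi (nonzero_val k)) <= 2.
  have := char_Im_norm_le1 chi (nonzero_val k); rewrite ler_norml; lra.
have [s sE] := summable_le_fin _ _ _ nu0 nus bnd.
have sEN : (\esum_(k in [set: nonzero H])
    ((1 - complex.Im (chi (nonzero_val k))) * nu k)%:E = s%:E)%E.
  rewrite -sE (@reindex_esum _ _ _ setT setT (@nonzero_opp H)).
    apply: eq_esum => k _; rewrite nuN /nonzero_val /= charN.
    by case: (chi (val k)) => a b /=; rewrite opprK.
  have oppK : involutive (@nonzero_opp H).
    by move=> k; apply: val_inj; rewrite /= opprK.
  split => //.
  - by move=> k l _ _; exact: (can_inj oppK).
  - by move=> k _; exists (nonzero_opp k).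
have h1 := esum_has_sum _ _ (fun k => mulr_ge0 (proj1 (andP (bnd k))) (nu0 k)) sE.
have h2 := esum_has_sum _ _ (fun k => mulr_ge0 (proj1 (andP (bndN k))) (nu0 k)) sEN.
have := has_sumZ _ _ (2^-1) (has_sumB _ _ _ _ h1 h2).
rewrite subrr mulr0; congr has_sum; apply/funext => k.
by field.
Qed.

(** Testing [mu] against an approximate indicator of [k0] isolates [mu k0]; the summable bound [b]
    controls the points where the approximation is poor. *)
Lemma null_measure_eq0 mu (b : nonzero H -> R) (B : R) :
    (forall k, `|mu k| <= b k) -> has_sum b B ->
    (forall (c : R[i]) chi,
      has_sum (fun k => complex.Re (c * (chi (nonzero_val k) - 1)) * mu k) 0) ->
  forall k, mu k = 0.
Proof.
move=> mub hb null k0.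
(* The constants [c] and characters [chi] make P stable under the products
   required by indicator_approx. *)
pose P (phi : H -> R[i]) := forall (c : R[i]) chi, has_sum (fun k =>
  complex.Re (c * (phi (nonzero_val k) * chi (nonzero_val k) - phi 0)) * mu k) 0.
have P1 : P (fun=> 1).
  by move=> c chi; under eq_fun do rewrite mul1r; exact: null.
have PM phi (a b' : R[i]) chi' : P phi -> P (fun h => phi h * (a + b' * chi' h)).
  move=> Pphi c chi.
  have chi2N h : `|chi' h * chi h| = 1 by rewrite normrM !char_norm mulr1.
  have chi2D g h :
      chi' (g + h) * chi (g + h) = chi' g * chi g * (chi' h * chi h).
    by rewrite !charD mulrACA.
  (* The product with [a + b' * chi'] splits into two instances of [P phi], for the characters [chi]
     and [chi' * chi]. *)
  have := has_sumD _ _ _ _ (Pphi (c * a) chi)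
    (Pphi (c * b') (Character chi2N chi2D)).
  rewrite addr0; congr has_sum; apply/funext => k /=.
  rewrite char0 mulr1 -mulrDl -raddfD; congr (complex.Re _ * _).
  by ring.
apply/eqP; rewrite -normr_le0; apply/ler_addgt0Pr => e e0; rewrite add0r.
(* The final error is at most [d + 2 * d * SJ + (SJ - S1)], with [SJ <= |B| + 1] and
   [SJ - S1 <= 2 * d]; this totals [d * (2 * |B| + 5)]. *)
pose d := Num.min 1 (e / (2 * `|B| + 5)).
have K0 : 0 < 2 * `|B| + 5 by rewrite ltr_wpDl// mulr_ge0.
have d0 : 0 < d by rewrite lt_min ltr01 divr_gt0.
have d1 : d <= 1 by rewrite ge_min lexx.
have de : d * (2 * `|B| + 5) <= e by rewrite -ler_pdivlMr// ge_min lexx orbT.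
have /has_sumP/(_ _ d0)[F1 hF1] := hb.
pose F := [seq nonzero_val k | k <- (F1 `\ k0)%fset : seq _].
(* The point 0 is included so that the constant [phi 0] is small as well. *)
have k0F : nonzero_val k0 \notin 0 :: F.
  rewrite inE negb_or (valP k0) /=; apply/negP => /mapP[k].
  by rewrite !inE => /andP[+ _] /val_inj kk0; rewrite kk0 eqxx.
have [phi [Pphi phik0 phi1 phiF]] := indicator_approx _ _ _ _ P1 PM k0F d0.
have h0 : has_sum (fun k => complex.Re (phi (nonzero_val k) - phi 0) * mu k) 0.
  have := Pphi 1 (char_triv H); congr has_sum; apply/funext => k /=.
  by rewrite mulr1 mul1r.
have /has_sumP/(_ _ d0)[F2 hF2] := h0.
pose J := (k0 |` (F1 `|` F2))%fset.
have F1J : (F1 `<=` J)%fset by apply/fsubsetP => x xF; rewrite !inE xF orbT.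
have F2J : (F2 `<=` J)%fset by apply/fsubsetP => x xF; rewrite !inE xF !orbT.
have := hF1 _ F1J; have := hF1 _ (fsubset_refl F1); have := hF2 _ F2J.
rewrite sub0r normrN.
set SJ := \sum_(i <- J) b i; set S1 := \sum_(i <- F1) b i.
have Re_le x r : `|phi x| <= r%:C%C -> `|complex.Re (phi x)| <= r.
  by move=> /(le_trans (normc_ge_Re _)); rewrite lecR.
have b0 k : 0 <= b k by exact: le_trans (normr_ge0 _) (mub k).
have tailE : \sum_(i <- J | i \notin F1) b i = SJ - S1.
  apply/eqP; rewrite eq_sym subr_eq addrC /SJ (bigID (mem F1))/=; apply/eqP.
  congr (_ + _); rewrite -big_filter; apply: perm_big; apply: uniq_perm.
  - by rewrite filter_uniq// fset_uniq.
  - exact: fset_uniq.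
  - by move=> x; rewrite mem_filter; case: (boolP (x \in F1)) => // /(fsubsetP F1J).
have muJ : `|\sum_(i <- J) mu i| <= SJ.
  by rewrite (le_trans (ler_norm_sum _ _ _))//; apply: ler_sum.
have phi0 : `|complex.Re (phi 0)| <= d by apply: Re_le; apply: phiF; rewrite inE eqxx.
pose r k := (complex.Re (phi (nonzero_val k)) - (k == k0)%:R) * mu k.
(* The remainder vanishes at [k0]. At other points of [F1], [phi] is at most [d]; outside [F1] it is
   at most 1, but there [b] has little mass. *)
have rb k : `|r k| <= d * b k + (if k \notin F1 then b k else 0).
  rewrite /r normrM; have [->|kk0] := eqVneq k k0.
    rewrite phik0 /= subrr normr0 mul0r addr_ge0 ?mulr_ge0 ?(ltW d0)//.
    by case: ifP.
  rewrite subr0; case: ifPn => kF1.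
    apply: ler_wpDl; first by rewrite mulr_ge0 ?(ltW d0).
    by rewrite -[leRHS]mul1r ler_pM// Re_le.
  rewrite addr0 ler_pM// Re_le// phiF// inE; apply/orP; right.
  by apply/mapP; exists k => //; rewrite !inE kk0 /= -[_ \in _]negbK.
have rJ : `|\sum_(i <- J) r i| <= d * SJ + (SJ - S1).
  rewrite (le_trans (ler_norm_sum _ _ _))// -tailE /SJ mulr_sumr.
  rewrite [X in _ + X]big_mkcond -big_split; apply: ler_sum => k _; exact: rb.
have -> : \sum_(i <- J) complex.Re (phi (nonzero_val i) - phi 0) * mu i =
    mu k0 + \sum_(i <- J) r i - complex.Re (phi 0) * \sum_(i <- J) mu i.
  have -> : mu k0 = \sum_(i <- J) (i == k0)%:R * mu i.
    rewrite (big_fsetD1 k0) /=; last by rewrite !inE eqxx.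
    rewrite eqxx mul1r big_seq big1 ?addr0// => i.
    by rewrite !inE => /andP[/negbTE ->]; rewrite mul0r.
  rewrite mulr_sumr -big_split -sumrB; apply: eq_bigr => i _.
  by rewrite raddfB /r /= -!mulrDl -mulrBl; congr (_ * _); ring.
set T := \sum_(i <- J) mu i in muJ *; set U := \sum_(i <- J) r i in rJ *.
have : `|complex.Re (phi 0) * T| <= d * SJ by rewrite normrM ler_pM.
move: (ler_norm B) (normr_ge0 B) rJ.
have SJ0 : 0 <= SJ by apply: sumr_ge0.
move: (complex.Re (phi 0) * T) => V.
rewrite !ler_norml !ltr_norml => hB B0 /andP[rJ1 rJ2] /andP[V1 V2] /andP[W1 W2]
  /andP[b11 b12] /andP[b21 b22].
have SJB : SJ <= `|B| + d by lra.
have dSJ : d * SJ <= d * (`|B| + 1) by rewrite ler_wpM2l ?(ltW d0)//; lra.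
have db : d * d <= d * 1 by rewrite ler_wpM2l ?(ltW d0).
apply/andP; split; lra.
Qed.

(** For the difference of the two measures, equal exponents cancel the sum of [Re (chi - 1)] and
    symmetry cancels that of [Im chi]. Together they give every [Re (c * (chi - 1))], as
    [null_measure_eq0] requires. *)
Lemma levy_measure_unique nu1 nu2 :
    (forall k, 0 <= nu1 k) -> (forall k, 0 <= nu2 k) ->
    (forall k, nu1 (nonzero_opp k) = nu1 k) ->
    (forall k, nu2 (nonzero_opp k) = nu2 k) ->
    summable [set: nonzero H] (fun k => (nu1 k)%:E) ->
    summable [set: nonzero H] (fun k => (nu2 k)%:E) ->
    (forall chi, (\esum_(k in [set: nonzero H])
        ((1 - complex.Re (chi (nonzero_val k))) * nu1 k)%:E =
      \esum_(k in [set: nonzero H])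
        ((1 - complex.Re (chi (nonzero_val k))) * nu2 k)%:E)%E) ->
  nu1 = nu2.
Proof.
move=> nu10 nu20 nu1N nu2N nu1s nu2s eq12.
have tot nu : (forall k, 0 <= nu k) ->
    summable [set: nonzero H] (fun k => (nu k)%:E) ->
    exists s, has_sum nu s.
  move=> nu0 nus.
  have [|s sE] := summable_le_fin _ 1 (fun=> 1) nu0 nus; first by rewrite ler01 lexx.
  exists s; apply: esum_has_sum => //; rewrite -sE.
  by apply: eq_esum => k _; rewrite mul1r.
have [s1 hs1] := tot _ nu10 nu1s.
have [s2 hs2] := tot _ nu20 nu2s.
suff nu12 k : nu1 k - nu2 k = 0.
  by apply/funext => k; apply/eqP; rewrite -subr_eq0 nu12.
move: k; apply: (null_measure_eq0 (fun k => nu1 k - nu2 k)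
  (fun k => nu1 k + nu2 k) (s1 + s2)).
- move=> k; rewrite (le_trans (ler_normB _ _))// !ger0_norm//.
- exact: has_sumD.
move=> c chi.
have bnd (k : nonzero H) : 0 <= 1 - complex.Re (chi (nonzero_val k)) <= 2.
  have := char_Re_le1 _ chi (nonzero_val k).
  have := char_Re_geN1 _ chi (nonzero_val k); lra.
have [s sE] := summable_le_fin _ _ _ nu10 nu1s bnd.
have h1 := esum_has_sum _ _ (fun k => mulr_ge0 (proj1 (andP (bnd k))) (nu10 k)) sE.
have sE2 := sE; rewrite eq12 in sE2.
have h2 := esum_has_sum _ _ (fun k => mulr_ge0 (proj1 (andP (bnd k))) (nu20 k)) sE2.
have hI := has_sumB _ _ _ _ (has_sum_Im _ chi nu10 nu1N nu1s)
  (has_sum_Im _ chi nu20 nu2N nu2s).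
have := has_sumB _ _ _ _ (has_sumZ _ _ (- complex.Re c) (has_sumB _ _ _ _ h1 h2))
  (has_sumZ _ _ (complex.Im c) hI).
rewrite !subrr !mulr0 subr0; congr has_sum; apply/funext => k.
case: c => c1 c2; case: (chi (nonzero_val k)) => a b /=.
by ring.
Qed.

End LevyUnique.

(** * Nonnegativity of the collapsed distance, and the application to the semigroup on K(X, A) *)

Lemma dist_to_ge0 (R : realType) (X : metricType R) (A : set X) (x : X) :
  A !=set0 -> 0 <= dist_to A x.
Proof.
move=> [a Aa]; apply: lb_le_inf; first by exists (mdist x a), a.
by move=> _ [b _ <-]; exact: mdist_ge0.
Qed.

Lemma dbar1_ge0 (R : realType) (X : metricType R) (A : set X) (u v : collapse A) :
  A !=set0 -> 0 <= dbar1 u v.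
Proof.
by move=> A0; rewrite /dbar1 /d1 le_min mdist_ge0/= addr_ge0 ?dist_to_ge0.
Qed.

Theorem theorem1 (R : realType) (X : metricType R) (A : set X)
    (A_neq0 : A !=set0) (X_discrete : uniformly_discrete A)
    (psi : R -> R) (psi_ge0 : forall r : R, 0 <= r -> 0 <= psi r)
    (psi0 : psi 0 = 0)
    (psi_sum : (\esum_(z in offdiag A) (psi (dbar1_off z.1 z.2))%:E < +oo)%E)
    (p : R -> KXA A -> R) (p_semigroup : is_conv_semigroup p)
    (p_fourier : forall (t : R) (theta : character R (KXA A)), 0 <= t ->
       fourier (p t) theta = ((expR (- (t * lambda_psi psi theta)))%:C)%C)
    (lambdaH : character R (H_of p) -> R)
    (lambdaH_ge0 : forall theta, 0 <= lambdaH theta)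
    (lambdaH_fourier : forall (t : R) (theta : character R (H_of p)), 0 <= t ->
       fourier (fun h => p t (H_val h)) theta =
         ((expR (- (t * lambdaH theta)))%:C)%C) :
  exists! nu : nonzero (H_of p) -> R,
    [/\ forall k, 0 <= nu k,
        forall k, nu (nonzero_opp k) = nu k,
        summable [set: nonzero (H_of p)] (fun k => (nu k)%:E)
      & forall theta : character R (H_of p),
          (lambdaH theta)%:E =
          \esum_(k in [set: nonzero (H_of p)])
            ((1 - complex.Re (theta (nonzero_val k))) * nu k)%:E].
Proof.
set S := \bigcup_(q in [set q : rat | 0 <= q]) supp (p (ratr q)).
pose w (z : set_type (~` A) * set_type (~` A)) := psi (dbar1_off z.1 z.2).
pose d (z : set_type (~` A) * set_type (~` A)) : KXA A := gen_e z.1 - gen_e z.2.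
have w0 z : 0 <= w z by apply/psi_ge0/dbar1_ge0.
(* Time 1 is rational, so [p 1] is carried by H; as the exponential is injective, this one time
   determines the exponents. *)
have p1S g : p 1 g != 0 -> g \in gen_subgroup S.
  have [/(_ _ ler01)[p0 _] _ _ _] := p_semigroup.
  move=> pg; apply/asboolP => M [_]; apply; exists 1; rewrite /= ?ler01//.
  by rewrite rmorph1 /supp /= lt0r pg p0.
have lamE (chi : character R (KXA A)) :
    fourier (p 1) chi = (expR (- jump_exponent (offdiag A) w d chi))%:C%C.
  by rewrite p_fourier// mul1r.
have exp_inj (a b : R) : (expR (- a))%:C%C = (expR (- b))%:C%C -> a = b.
  by move=> [/expR_inj/oppr_inj].
have ext (chi1 chi2 : character R (KXA A)) :
    (forall g, g \in gen_subgroup S -> chi1 g = chi2 g) ->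
    jump_exponent (offdiag A) w d chi1 = jump_exponent (offdiag A) w d chi2.
  move=> e12; apply: exp_inj; rewrite -!lamE; apply: fourier_ext => g /p1S.
  exact: e12.
pose nu := levy_measure (offdiag A) w d S.
have nu_exponent theta : (lambdaH theta)%:E =
    \esum_(k in [set: nonzero (H_of p)])
      ((1 - complex.Re (theta (nonzero_val k))) * nu k)%:E.
  have subS : is_subgroup [set g | g \in gen_subgroup S].
    by have [M0 MB] := gen_subgroup_zmod_closed S; split => [//|x y]; exact: MB.
  (* Outside H the value 1 is a default; [character_extends] reads [f] on H only. *)
  pose f (g : KXA A) : R[i] := if insub g is Some h then theta h else 1.
  have fE (h : H_of p) : f (gen_val h) = theta h by rewrite /f valK.
  have fS g : g \in gen_subgroup S -> exists h : H_of p, g = gen_val h.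
    by move=> gS; exists (GenElt gS).
  have [chi chiE] : exists chi : character R (KXA A),
      forall g, g \in gen_subgroup S -> chi g = f g.
    apply: (character_extends _ _ subS).
      by move=> g /fS[h ->]; rewrite fE char_norm.
    by move=> g h /fS[g' ->] /fS[h' ->]; rewrite !fE -charD -fE.
  have chi_ext (h : H_of p) : chi (gen_val h) = theta h.
    by rewrite chiE ?fE//; exact: gen_valP.
  rewrite -(levy_khintchine _ _ _ _ w0 psi_sum ext _ _ chi_ext); congr EFin.
  (* The Fourier transform of [p 1] at [chi] equals that of its restriction to H at [theta], which
     identifies the two exponents. *)
  have lamHE := lambdaH_fourier 1 theta ler01; rewrite mul1r in lamHE.
  apply: exp_inj; apply: (etrans (esym lamHE)).
  apply: etrans (lamE chi); apply/esym/fourier_restrict => //; first exact: val_inj.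
  by move=> g /p1S/fS[h ->]; exists h.
have nuP : [/\ forall k, 0 <= nu k, forall k, nu (nonzero_opp k) = nu k
  & summable [set: nonzero (H_of p)] (fun k => (nu k)%:E)].
  split.
  - by move=> k; exact: levy_measure_ge0.
  - apply: (levy_measure_sym _ _ _ _ w0 psi_sum (fun z => (z.2, z.1))).
    + by case.
    + by move=> z; rewrite /offdiag /= eq_sym.
    + by move=> z; rewrite /w /dbar1_off /dbar1 d1_sym.
    + by move=> z; rewrite /d opprB.
  - exact: (levy_measure_summable _ _ _ _ w0 psi_sum ext).
have [nu0 nuN nus] := nuP.
exists nu; split => // nu' [nu'0 nu'N nu's nu'_exponent].
apply: levy_measure_unique => // theta.
by rewrite -nu_exponent.
Qed.
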